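(* Let $X_1,X_2,\ldots$ be independent random elements of $\mathcal H$ with common law $P$. Assume that: (1) for some $q\ge 2$, the directions $\phi_{\mathrm R,j}=\phi_{\mathrm R,j}(P)$, $1\le j\le q$, are unique up to a sign change; (2) the function $\sigma:\mathcal H\to\mathbb R$, $\sigma(\alpha)=\sigma_{\mathrm R}(P[\alpha])$, is continuous with respect to the weak topology of $\mathcal H$; (3) $\sup_{\|\alpha\|=1}|s_n^2(\alpha)-\sigma^2(\alpha)|\to 0$ almost surely. Let $\widehat\phi_{\mathrm{SI},m}$ and $\widehat\lambda_{\mathrm{SI},m}$ be the sieve estimators $$\widehat\phi_{\mathrm{SI},1}=\arg\max_{\alpha\in\mathcal S_{p_n}}s_n(\alpha),\qquad \widehat\phi_{\mathrm{SI},m}=\arg\max_{\alpha\in\widehat{\mathcal B}_{n,m}}s_n(\alpha),\ m\ge 2,\qquad \widehat\lambda_{\mathrm{SI},m}=s_n^2(\widehat\phi_{\mathrm{SI},m}),$$ where $\widehat{\mathcal B}_{n,m}=\{\alpha\in\mathcal S_{p_n}:\langle\alpha,\widehat\phi_{\mathrm{SI},j}\rangle=0\ \text{ for all }1\le j\le m-1\}$. If $p_n\to\infty$, then, as $n\to\infty$: (a) $\widehat\lambda_{\mathrm{SI},1}\to\sigma^2(\phi_{\mathrm R,1})$ and $\sigma^2(\widehat\phi_{\mathrm{SI},1})\to\sigma^2(\phi_{\mathrm R,1})$ almost surely. (b) Given $2\le m\le q$, if $\widehat\phi_{\mathrm{SI},\ell}\to\phi_{\mathrm R,\ell}$ almost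 surely for $1\le\ell\le m-1$, then $\widehat\lambda_{\mathrm{SI},m}\to\sigma^2(\phi_{\mathrm R,m})$ and $\sigma^2(\widehat\phi_{\mathrm{SI},m})\to\sigma^2(\phi_{\mathrm R,m})$ almost surely. (c) For $1\le m\le q$, $\langle\widehat\phi_{\mathrm{SI},m},\phi_{\mathrm R,m}\rangle^2\to 1$ almost surely.
   Context: $\mathcal H$ is a separable real Hilbert space with inner product $\langle\cdot,\cdot\rangle$ and norm $\|\cdot\|$. Scale functional: let $\mathcal G$ be the set of all univariate probability distributions. A scale functional is a map $\sigma_{\mathrm R}:\mathcal G\to[0,+\infty)$ such that, for all real $a,b$ and all $G\in\mathcal G$, $\sigma_{\mathrm R}(G_{a,b})=|a|\,\sigma_{\mathrm R}(G)$, where $G_{a,b}$ is the distribution of $aY+b$ when $Y\sim G$. A scale functional $\sigma_{\mathrm R}$ is fixed. For a probability measure $Q$ on $\mathcal H$ and $\alpha\in\mathcal H$, $Q[\alpha]$ denotes the distribution of $\langle\alpha,X\rangle$ when $X\sim Q$. $P_n$ is the empirical measure of $X_1,\ldots,X_n$, and $s_n(\alpha)=\sigma_{\mathrm R}(P_n[\alpha])$, i.e. $\sigma_{\mathrm R}$ evaluated at the empirical distribution of $\langle\alpha,X_1\rangle,\ldots,\langle\alpha,X_n\rangle$. Principal directions: $\phi_{\mathrm R,1}(P)=\arg\max_{\|\alpha\|=1}\sigma_{\mathrm R}(P[\alpha])$ and, for $m\ge 2$, $\phi_{\mathrm R,m}(P)=\arg\max_{\|\alpha\|=1,\ \alpha\in\mathcal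 B_m}\sigma_{\mathrm R}(P[\alpha])$, where $\mathcal B_m=\{\alpha\in\mathcal H:\langle\alpha,\phi_{\mathrm R,j}(P)\rangle=0,\ 1\le j\le m-1\}$. Sieve: $\{\delta_i\}_{i\ge1}$ is a basis of $\mathcal H$, $\mathcal H_{p_n}$ is the linear span of $\delta_1,\ldots,\delta_{p_n}$, and $\mathcal S_{p_n}=\{\alpha\in\mathcal H_{p_n}:\|\alpha\|=1\}$. Throughout, $\arg\max$ denotes an element attaining the maximum (the maximizers are understood to exist). The signs of the directions are arbitrary. *)

(* Defs.v *)
From HB Require Import structures.
From mathcomp Require Import all_boot all_order all_algebra.
From mathcomp Require Import finmap.
From mathcomp Require Import all_classical all_reals all_analysis.
From mathcomp Require Import measurable_realfun ring lra.
Import Order.TTheory GRing.Theory Num.Theory.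
Import numFieldNormedType.Exports.

Set Implicit Arguments.
Unset Strict Implicit.
Unset Printing Implicit Defensive.

Local Open Scope classical_set_scope.
Local Open Scope ring_scope.

HB.mixin Record CompleteNormedModule_isHilbert (R : realType) H
    & CompleteNormedModule R H := {
  inner : H -> H -> R ;
  innerC : forall x y : H, inner x y = inner y x ;
  innerDl : forall x y z : H, inner (x + y) z = inner x z + inner y z ;
  innerZl : forall (a : R) (x y : H), inner (a *: x) y = a * inner x y ;
  inner_norm : forall x : H, inner x x = `|x| ^+ 2
}.

#[short(type="hilbertType")]
HB.structure Definition Hilbert (R : realType) :=
  {H of CompleteNormedModule R H & CompleteNormedModule_isHilbert R H}.

Notation borel T := (g_sigma_algebraType (@open T)).

Section hilbert.
Context {R : realType} {H : hilbertType R}.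
Implicit Types x y : H.

Definition separable := exists2 D : set H, countable D & dense D.

(* [{linear H -> R^o}] contains the discontinuous functionals too. *)
Definition dual := {f : {linear H -> R^o} | continuous f}.

Definition dual_eval x : {ptws dual -> R^o} := fun f => sval f x.

(* Coarsest topology making all continuous linear functionals continuous. *)
Definition weak := initial_topology dual_eval.

Definition schauder_basis (delta : nat -> H) :=
  forall x, exists! a : nat -> R,
    series (fun i => a i *: delta i) n @[n --> \oo] --> x.

Definition span_first (delta : nat -> H) (k : nat) : set H :=
  [set x | exists a : 'I_k -> R, x = \sum_(i < k) a i *: delta i].

Lemma inner_polar x y :
  inner x y = 4^-1 * (`|x + y| ^+ 2 - `|x - y| ^+ 2).
Proof.
have Nl u v : inner (- u) v = - inner u v by rewrite -scaleN1r innerZl mulN1r.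
have Dr u v w : inner u (v + w) = inner u v + inner u w.
  by rewrite innerC innerDl !(innerC _ u).
rewrite -!inner_norm !innerDl !Dr !Nl !(innerC _ (- y)) !Nl (innerC y x).
by field.
Qed.

Lemma inner_continuous x : continuous (inner x : H -> R).
Proof.
have -> : (inner x : H -> R) =
    (fun y => 4^-1 * (`|x + y| * `|x + y| - `|x - y| * `|x - y|)).
  by apply/funext => y; rewrite inner_polar !expr2.
move=> y; apply: cvgM; first exact: cvg_cst.
have cD : x + z @[z --> y] --> x + y by apply: cvgD; [exact: cvg_cst|].
have cB : x - z @[z --> y] --> x - y by apply: cvgB; [exact: cvg_cst|].
by apply: cvgB; apply: cvgM; apply: cvg_norm.
Qed.

Lemma inner_measurable x :
  measurable_fun [set: borel H] (inner x : borel H -> R).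
Proof.
apply: (@measurability _ _ (borel H) R _ _ (@RGenOpens.G R)).
  exact: RGenOpens.measurableE.
move=> _ [_ [a [b ->]] <-].
rewrite setTI; apply: sub_sigma_algebra.
move/continuousP: (@inner_continuous x); apply.
exact: interval_open.
Qed.

HB.instance Definition _ x :=
  isMeasurableFun.Build _ _ (borel H) R (inner x : borel H -> R)
    (inner_measurable x).

End hilbert.
Arguments separable {R} H.
Arguments weak {R} H.

Section affine.
Context {R : realType}.

Definition affine (a b : R) : R -> R := fun y => a * y + b.

Lemma affine_measurable a b : measurable_fun [set: R] (affine a b).
Proof. by apply: measurable_funD => //; exact: measurable_funM. Qed.

HB.instance Definition _ a b :=
  isMeasurableFun.Build _ _ R R (affine a b) (affine_measurable a b).

End affine.

Section empirical.
Context {d} {T : measurableType d} {R : realType} (x : nat -> T) (n : nat).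

(* The sample is [x 0, .., x n], of size n + 1, so that no size is zero. *)
Definition empirical : set T -> \bar R :=
  mscale (n.+1%:R^-1)%:nng (msum (fun i => \d_(x i)) n.+1).

HB.instance Definition _ := Measure.on empirical.

Lemma empirical_setT : empirical setT = 1%E.
Proof.
rewrite /empirical /mscale /= /msum (eq_bigr (fun=> 1%E)); last first.
  by move=> i _; exact: diracT.
by rewrite sumEFin sumr_const card_ord -EFinM mulVf.
Qed.

HB.instance Definition _ :=
  Measure_isProbability.Build _ _ _ empirical empirical_setT.

End empirical.

Section scale.
Context {R : realType}.
Implicit Types (sigmaR : probability R R -> R) (G : probability R R).

(* A [probability] also has values on non-measurable sets: the first clause
   makes [sigmaR] a function of the distribution only. *)
Definition scale_functional sigmaR :=
  [/\ forall G G', (forall A, measurable A -> G A = G' A) ->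
        sigmaR G = sigmaR G',
      forall G, 0 <= sigmaR G &
      forall (a b : R) G,
        sigmaR (distribution G (affine a b)) = `|a| * sigmaR G].

Definition projected_scale {H : hilbertType R} sigmaR
    (Q : probability (borel H) R) (alpha : H) : R :=
  sigmaR (distribution Q (inner alpha)).

End scale.

Definition mutually_independent {d d'} {Omega : measurableType d}
    {T : measurableType d'} {R : realType} (Pr : probability Omega R)
    (X : nat -> Omega -> T) :=
  forall (I : {fset nat}) (B : nat -> set T), (forall i, measurable (B i)) ->
    Pr (\bigcap_(i in [set` I]) (X i @^-1` B i)) =
    (\prod_(i <- I) Pr (X i @^-1` B i))%E.

Definition is_argmax {T : Type} {R : realType} (A : set T) (f : T -> R)
    (x : T) := A x /\ forall y, A y -> f y <= f x.

Section directions.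
Context {R : realType} {H : hilbertType R}.
Implicit Types (sigma : H -> R) (phi : nat -> H).

(* Directions are numbered from 1; [phi 0] is a dummy. *)
Definition feasible phi (m : nat) : set H :=
  [set alpha | `|alpha| = 1 /\
    forall j, (1 <= j < m)%N -> inner alpha (phi j) = 0].

Definition principal_directions sigma phi (q : nat) :=
  forall m, (1 <= m <= q)%N -> is_argmax (feasible phi m) sigma (phi m).

Definition unique_up_to_sign sigma phi (q : nat) :=
  forall m, (1 <= m <= q)%N -> forall alpha,
    is_argmax (feasible phi m) sigma alpha ->
    alpha = phi m \/ alpha = - phi m.

(* [s n], [k n] and [phihat n] are the empirical scale, the dimension of the
   sieve and the estimators for the [n]-th sample. The feasible set of the
   [m]-th problem is empty when [k n < m]. *)
Definition sieve_estimators (s : nat -> H -> R) (delta : nat -> H)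
    (k : nat -> nat) (phihat : nat -> nat -> H) (q : nat) :=
  forall n m, (1 <= m <= q)%N -> (m <= k n)%N ->
    is_argmax (span_first delta (k n) `&` feasible (phihat n) m) (s n)
      (phihat n m).

End directions.

(* Main.v *)
Require Import Defs.
From HB Require Import structures.
From mathcomp Require Import all_boot all_order all_algebra.
From mathcomp Require Import all_classical all_reals all_analysis.
From mathcomp Require Import ring lra.
Import Order.TTheory GRing.Theory Num.Theory.
Import numFieldNormedType.Exports.

Local Open Scope classical_set_scope.
Local Open Scope ring_scope.

(** The three conclusions are deterministic: they hold at every outcome at which
the empirical scale converges uniformly on the unit sphere
([sieve_consistency]), and they are proved together, for all directions, by
strong induction on the index [m].

Suppose that the squared cosines between the earlier estimators and the earlier
directions tend to 1.

Lower bound. Since the basis spans a dense subspace and the dimension of the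
sieve tends to infinity, [phi m] is a norm limit of sieve vectors. Removing from
them their components along the earlier estimators, and normalizing, changes
nothing in the limit, because [phi m] is asymptotically orthogonal to these
estimators; the result is feasible for the [m]-th empirical problem
([sieve_competitor]). Hence the empirical maximum is asymptotically at least
[sigma (phi m)].

Upper bound. The estimators are unit vectors, so every ultrafilter finer than
the filter at infinity has a weak limit [a] of them, with norm at most 1
([ultra_weak_cvg]), and [a] is orthogonal to the earlier directions. By weak
continuity [sigma] of the estimators tends to [sigma a], so
[sigma (phi m) <= sigma a]. On the other hand homogeneity gives
[sigma a <= `|a| * sigma (phi m)] ([scale_le_principal]). As [sigma (phi m)] is
positive, this forces [`|a| = 1]; then [a] is a maximizer, and by uniqueness it
is [phi m] or [- phi m] ([weak_maximizer]). All ultrafilters thus yield the same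
limits, so these are limits at infinity ([cvg_ultra]).

Positivity of [sigma (phi m)] comes from uniqueness. If it were 0, [sigma] would
vanish at all feasible unit vectors, which would all be maximizers; but a space
with an infinite Schauder basis contains a feasible unit vector orthogonal to
[phi m] as well ([schauder_basis_orthogonal]).

Working with squared cosines makes the choice of signs immaterial: Bessel's
inequality for two orthonormal vectors ([bessel_two]) turns a squared cosine
close to 1 into approximate orthogonality to everything orthogonal to the
other vector. *)

(** * Ultrafilters and limits *)

Section ultrafilters.
Context {T : Type}.

(** If a neighborhood of [l] were missed, the trace of [F] on its preimage's
complement would be a proper filter, contained in some ultrafilter. *)
Lemma cvg_ultra {U : topologicalType} (F : set_system T) {FF : Filter F}
    (f : T -> U) (l : U) :
  (forall G, UltraFilter G -> F `<=` G -> f @ G --> l) -> f @ F --> l.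
Proof.
move=> cvgG A Al; apply: contrapT => nFA.
have PF : ProperFilter (within (~` (f @^-1` A)) F).
  split; last exact: within_filter.
  by rewrite /within /= => F0; apply: nFA; apply: filterS F0 => x /contrapT.
have [G [GU sG]] := ultraFilterLemma PF.
have FG : F `<=` G.
  by move=> B FB; apply: sG; rewrite /within /=; apply: filterS FB.
have GA : G (f @^-1` A) by exact: (cvgG G GU FG).
have GnA : G (~` (f @^-1` A)) by apply: sG; exact: withinT.
by have [x []] := filter_ex (filterI GA GnA).
Qed.

Lemma ultra_bounded_cvg {R : realType} (G : set_system T) {GU : UltraFilter G}
    (f : T -> R) (M : R) :
  (\forall x \near G, `|f x| <= M) -> cvg (f x @[x --> G]).
Proof.
move=> fM.
have fGM : (f @ G) `[- M, M]%classic.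
  by apply: filterS fM => x; rewrite /= in_itv /= ler_norml.
have [c [_ clc]] := @segment_compact R (- M) M (f @ G) _ fGM.
apply/cvg_ex; exists c => A Ac.
have [//|GnA] := in_ultra_setVsetC (f @^-1` A) GU.
have /(_ GnA Ac) [x [nAx Ax]] := clc (~` A) A.
by [].
Qed.

End ultrafilters.

(** * Algebra of the inner product *)

Section inner_product.
Context {R : realType} {H : hilbertType R}.
Implicit Types (x y z : H) (a : R).

Lemma inner0l y : inner 0 y = 0.
Proof. by rewrite -(scale0r 0) innerZl mul0r. Qed.

Lemma innerNl x y : inner (- x) y = - inner x y.
Proof. by rewrite -scaleN1r innerZl mulN1r. Qed.

Lemma innerBl x y z : inner (x - y) z = inner x z - inner y z.
Proof. by rewrite innerDl innerNl. Qed.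

Lemma innerDr x y z : inner x (y + z) = inner x y + inner x z.
Proof. by rewrite innerC innerDl !(innerC _ x). Qed.

Lemma innerZr a x y : inner x (a *: y) = a * inner x y.
Proof. by rewrite innerC innerZl innerC. Qed.

Lemma innerNr x y : inner x (- y) = - inner x y.
Proof. by rewrite innerC innerNl innerC. Qed.

Lemma innerBr x y z : inner x (y - z) = inner x y - inner x z.
Proof. by rewrite innerDr innerNr. Qed.

Lemma inner_suml (I : Type) (r : seq I) (P : pred I) (F : I -> H) y :
  inner (\sum_(i <- r | P i) F i) y = \sum_(i <- r | P i) inner (F i) y.
Proof.
by apply: (big_morph (inner^~ y)) => [u v|]; rewrite ?innerDl ?inner0l.
Qed.

Lemma inner_cauchy_schwarz x y : `|inner x y| <= `|x| * `|y|.
Proof.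
have [->|x0] := eqVneq x 0; first by rewrite inner0l !normr0 mul0r.
have nx : 0 < `|x| ^+ 2 by rewrite exprn_gt0 ?normr_gt0.
rewrite -(@ler_pXn2r _ 2) ?nnegrE ?mulr_ge0 // real_normK ?num_real //.
(* the square whose nonnegativity yields the inequality after expansion *)
have := sqr_ge0 `|(`|x| ^+ 2) *: y - inner x y *: x|.
rewrite -inner_norm !(innerBl, innerBr, innerZl, innerZr) !inner_norm.
rewrite (innerC y x).
set i := inner x y => h.
have : 0 <= `|x| ^+ 2 * (`|x| ^+ 2 * `|y| ^+ 2 - i ^+ 2) by lra.
by rewrite pmulr_rge0 // subr_ge0 exprMn.
Qed.

Lemma inner_cvg {T : Type} (F : set_system T) {FF : Filter F} (f g : T -> H)
    x y :
  f @ F --> x -> g @ F --> y -> inner (f t) (g t) @[t --> F] --> inner x y.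
Proof.
move=> fx gy; rewrite inner_polar.
under eq_fun do rewrite inner_polar.
apply: cvgM; first exact: cvg_cst.
by apply: cvgB; rewrite expr2; under eq_fun do rewrite expr2;
  apply: cvgM; apply: cvg_norm;
  [apply: cvgD|apply: cvgD|apply: cvgB|apply: cvgB].
Qed.

Lemma norm_sub_proj x y : `|x| = 1 -> `|y| = 1 ->
  `|y - inner x y *: x| ^+ 2 = 1 - inner x y ^+ 2.
Proof.
move=> x1 y1.
rewrite -inner_norm !(innerBl, innerBr, innerZl, innerZr) !inner_norm.
by rewrite x1 y1 (innerC y x); ring.
Qed.

(** Bessel's inequality for the orthonormal pair [v], [w]: the component of [u]
along [w] is also that of its residual after projection on [v]. *)
Lemma bessel_two (u v w : H) :
  `|u| = 1 -> `|v| = 1 -> `|w| = 1 -> inner w v = 0 ->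
  inner w u ^+ 2 <= 1 - inner v u ^+ 2.
Proof.
move=> u1 v1 w1 wv.
have -> : inner w u = inner w (u - inner v u *: v).
  by rewrite innerBr innerZr wv mulr0 subr0.
rewrite -(norm_sub_proj v u v1 u1).
have := inner_cauchy_schwarz w (u - inner v u *: v); rewrite w1 mul1r.
by rewrite -(@ler_pXn2r _ 2) ?nnegrE // real_normK ?num_real.
Qed.

(** What the alignment of [u] with [v] is used for: it needs no choice of sign
and makes [u] asymptotically orthogonal to whatever is orthogonal to [v]. *)
Lemma bessel_two_cvg {T : Type} (F : set_system T) {FF : Filter F}
    (u v w : T -> H) :
  (\forall t \near F, [/\ `|u t| = 1, `|v t| = 1, `|w t| = 1 &
     inner (w t) (v t) = 0]) ->
  inner (v t) (u t) ^+ 2 @[t --> F] --> (1 : R) ->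
  inner (w t) (u t) @[t --> F] --> (0 : R).
Proof.
move=> uvw vu1; apply/cvgr0Pnorm_lt => e e0.
have e2 : 0 < e ^+ 2 by rewrite exprn_gt0.
have vu : \forall t \near F, 1 - e ^+ 2 < inner (v t) (u t) ^+ 2.
  by apply: (cvgr_gt _ vu1); rewrite ltrBlDr ltrDl.
near=> t.
rewrite -(@ltr_pXn2r _ 2) ?nnegrE // 1?ltW // real_normK ?num_real //.
have [u1 v1 w1 wv] : [/\ `|u t| = 1, `|v t| = 1, `|w t| = 1 &
     inner (w t) (v t) = 0] by near: t.
apply: le_lt_trans (bessel_two _ _ _ u1 v1 w1 wv) _.
by rewrite ltrBlDr addrC -ltrBlDr; near: t.
Unshelve. all: by end_near. Qed.

End inner_product.

(** * Riesz representation and weak compactness of balls *)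

Section weak_convergence.
Context {R : realType} {H : hilbertType R}.

(** The representing vector minimizes the quadratic functional
[J x = `|x| ^+ 2 - 2 * f x]. By the parallelogram identity minimizing sequences
are Cauchy, and the Euler equation of [J] at its minimizer [a] is
[f = inner a]. *)
Lemma riesz_representation (f : {linear H -> R^o}) (M : R) :
  (forall x, `|f x| <= M * `|x|) -> exists a, forall x, f x = inner a x.
Proof.
move=> fM.
have fcont : continuous (f : H -> R).
  apply: bounded_linear_continuous; apply/linear_boundedP.
  exists M; split; first exact: num_real.
  move=> r Mr x; apply: le_trans (fM x) _.
  by rewrite ler_wpM2r // ltW.
have fD (x y : H) : f (x + y) = (f x : R) + f y by exact: linearD.
have fZ c (x : H) : f (c *: x) = c * (f x : R) by exact: linearZ.
pose J (x : H) : R := `|x| * `|x| - 2 * f x.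
have Jcont : continuous J.
  move=> x; apply: cvgB; last by apply: cvgM; [exact: cvg_cst|exact: fcont].
  by apply: cvgM; exact: norm_continuous.
have Jlb x : - M ^+ 2 <= J x.
  have := fM x; rewrite ler_norml => /andP[_ fx].
  have := sqr_ge0 (`|x| - M); rewrite /J => h; nra.
have [S0 Slb] : range J !=set0 /\ has_lbound (range J).
  split; first by exists (J 0), 0.
  by exists (- M ^+ 2) => _ [x _ <-].
pose I := inf (range J).
have IJ x : I <= J x by apply: ge_inf => //; exists x.
(* the parallelogram identity, with [J] at the midpoint bounded below by [I] *)
have Jgap x y : `|x - y| * `|x - y| <= 2 * (J x - I) + 2 * (J y - I).
  have := IJ (2^-1 *: (x + y)).
  rewrite /J fZ fD -!expr2 -!inner_norm.
  rewrite !(innerBl, innerBr, innerDl, innerDr, innerZl, innerZr) (innerC y x).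
  set p := inner x x; set q := inner y y; set r := inner x y.
  set u := f x; set v := f y.
  lra.
have minJ (n : nat) : exists x, J x < I + n.+1%:R^-1.
  have e0 : (0 : R) < n.+1%:R^-1 by rewrite invr_gt0.
  by have [_ [x _ <-] Jx] := inf_adherent e0 (conj S0 Slb); exists x.
have [u uJ] := choice minJ.
have uI : J (u n) @[n --> \oo] --> I.
  apply: (@squeeze_cvgr _ _ _ _ (fun=> I) (fun n => I + n.+1%:R^-1)).
  - by apply: nearW => n; rewrite IJ ltW.
  - exact: cvg_cst.
  - rewrite -[X in _ --> X]addr0; apply: cvgD; first exact: cvg_cst.
    exact: cvg_harmonic.
have ucauchy : cauchy (u n @[n --> \oo]).
  apply/cauchy_ballP => e e0.
  have e4 : 0 < e ^+ 2 / 4 by rewrite divr_gt0 // exprn_gt0.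
  have near1 : \forall n \near \oo, J (u n) < I + e ^+ 2 / 4.
    by apply: (cvgr_lt I) => //; rewrite ltrDl.
  near=> x y; rewrite -ball_normE /ball_ /=.
  suff: `|x - y| * `|x - y| < e * e.
    by rewrite -!expr2 ltr_pXn2r // nnegrE // ltW.
  apply: le_lt_trans (Jgap x y) _.
  have : J x < I + e ^+ 2 / 4 by near: x; exact: near1.
  have : J y < I + e ^+ 2 / 4 by near: y; exact: near1.
  rewrite expr2; lra.
have /cvg_ex[a ua] : cvg (u n @[n --> \oo]) by exact: cauchy_cvg.
have Ja : J a = I.
  apply: (@cvg_unique _ _ (J (u n) @[n --> \oo])) => //.
  exact: (cvg_comp _ _ ua (Jcont a)).
exists a => y; apply/esym/eqP; rewrite -subr_eq0; apply/eqP.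
set c := inner a y - f y.
(* [K] exceeds the norm of [y] squared, so that moving by [t = - c / K] along
   [y] would strictly decrease [J] if [c] were nonzero *)
pose K := `|y| ^+ 2 + 1.
have K0 : 0 < K by rewrite /K ltr_wpDl // sqr_ge0.
pose t := - c / K.
have : J a <= J (a + t *: y) by rewrite Ja.
rewrite /J fD fZ -!expr2 -!inner_norm.
rewrite !(innerDl, innerDr, innerZl, innerZr) (innerC y a).
rewrite (inner_norm y) => h.
have ct : c = - t * K by rewrite /t mulNr divfK ?opprK // gt_eqF.
have : 0 <= - t ^+ 2 * (K + 1).
  have : 0 <= t ^+ 2 * `|y| ^+ 2 + 2 * t * c by rewrite /c; lra.
  rewrite ct; rewrite /K; lra.
have K1 : 0 < K + 1 by rewrite addr_gt0.
rewrite pmulr_lge0 // oppr_ge0 => t2.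
have /eqP : t ^+ 2 = 0 by apply/eqP; rewrite eq_le t2 sqr_ge0.
by rewrite sqrf_eq0 => /eqP t0; rewrite ct t0 oppr0 mul0r.
Unshelve. all: by end_near. Qed.

(** The weak topology is initial for the continuous functionals, and these are
the maps [inner b] by Riesz representation. *)
Lemma cvg_weak {T : Type} (F : set_system T) {FF : Filter F} (x : T -> H)
    (a : H) :
  (forall y, inner (x t) y @[t --> F] --> inner a y) ->
  x t @[t --> F] --> (a : weak H).
Proof.
move=> xa.
have dualx : {ptws, dual_eval (x t) @[t --> F] --> dual_eval a}.
  rewrite cvg_sup => -[f fc].
  rewrite cvg_image; last by rewrite eqEsubset; split=> v // _; exists (cst v).
  suff fx : (f (x t) : R^o) @[t --> F] --> f a.
    move=> W /= /fx FW; exists ((fun g => g (exist _ f fc)) @^-1` W) => //.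
    by rewrite eqEsubset; split => [j [? + <-//]|j Wj]; exists (fun=> j).
  have [M [_ fM]] := (linear_boundedP f).1 ((linear_bounded_continuous f).2 fc).
  have [b fb] : exists b, forall y, f y = inner b y.
    by apply: (@riesz_representation f (M + 1)); apply: fM; rewrite ltrDl.
  by rewrite fb innerC; under eq_fun do rewrite fb innerC; exact: xa.
move=> A [_ [[B Bo <-] Ba BA]].
have FB : F (fun t => B (dual_eval (x t))).
  by apply: dualx; exact: open_nbhs_nbhs.
by apply: filterS FB => t; exact: BA.
Qed.

(** Weak compactness of balls: along an ultrafilter each bounded scalar
[inner (x t) y] has a limit, this limit is linear and bounded in [y], and its
Riesz representative is the weak limit. *)
Lemma ultra_weak_cvg {T : Type} (G : set_system T) {GU : UltraFilter G}
    (x : T -> H) (M : R) :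
  (\forall t \near G, `|x t| <= M) ->
  exists a, forall y, inner (x t) y @[t --> G] --> inner a y.
Proof.
move=> xM.
have cvgy y : cvg (inner (x t) y @[t --> G]).
  apply: (@ultra_bounded_cvg _ _ _ _ _ (M * `|y|)).
  apply: filterS xM => t xtM; apply: le_trans (inner_cauchy_schwarz _ _) _.
  by rewrite ler_wpM2r.
pose L y : R := lim (inner (x t) y @[t --> G]).
have Llin : linear (L : H -> R^o).
  move=> c y z; rewrite /L.
  apply: cvg_lim => //.
  under eq_fun do rewrite innerDr innerZr.
  apply: cvgD; last exact: cvgy.
  by apply: cvgM; [exact: cvg_cst|exact: cvgy].
have LM y : `|L y| <= M * `|y|.
  have cvgLy : `|inner (x t) y| @[t --> G] --> `|L y|.
    exact: cvg_norm (cvgy y).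
  apply: (cvgr_to_le cvgLy).
  apply: filterS xM => t xtM; apply: le_trans (inner_cauchy_schwarz _ _) _.
  by rewrite ler_wpM2r.
pose mL := GRing.isLinear.Build R H R^o _ L Llin.
pose LL : {linear H -> R^o} := HB.pack L mL.
have [a La] := @riesz_representation LL M LM.
by exists a => y; rewrite -La; exact: cvgy.
Qed.

End weak_convergence.

(** * Schauder bases and homogeneity of the scale *)

Section scale_and_basis.
Context {R : realType} {H : hilbertType R}.

Lemma projected_scaleZ (sigmaR : probability R R -> R)
    (Q : probability (borel H) R) (a : R) (x : H) :
  scale_functional sigmaR ->
  projected_scale sigmaR Q (a *: x) = `|a| * projected_scale sigmaR Q x.
Proof.
case=> ext _ scale; rewrite /projected_scale -(scale a 0); apply: ext => A mA.
rewrite /distribution /pushforward /=; congr (Q _).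
by apply/seteqP; split => y /=; rewrite /affine /= addr0 innerZl.
Qed.

(** A vanishing combination, extended by zeros, and the zero sequence are two
expansions of 0. *)
Lemma schauder_basis_free (delta : nat -> H) (N : nat) (c : 'I_N -> R) :
  schauder_basis delta -> \sum_(i < N) c i *: delta i = 0 -> forall i, c i = 0.
Proof.
move=> basis sum0 i.
pose b j := if insub j is Some k then c k else 0.
have bE (k : 'I_N) : b k = c k by rewrite /b valK.
have b0 : series (fun j => b j *: delta j) n @[n --> \oo] --> 0.
  have Sb n : (N <= n)%N -> series (fun j => b j *: delta j) n = 0.
    move=> Nn; rewrite /series /= (big_cat_nat (leq0n N) Nn) //=.
    rewrite [X in _ + X]big_nat_cond.
    rewrite [X in _ + X]big1 ?addr0 => [|j /andP[/andP[Nj _] _]].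
      by rewrite big_mkord -[RHS]sum0; apply: eq_bigr => k _; rewrite bE.
    by rewrite /b insubF ?scale0r // ltnNge Nj.
  apply: (@cvg_near_cst _ _ 0); exists N => // n /= Nn; exact: Sb.
have z0 : series (fun j => (0 : R) *: delta j) n @[n --> \oo] --> 0.
  apply: cvg_near_cst; apply: nearW => n.
  by rewrite /series /= big1 // => j _; rewrite scale0r.
have [a [_ aU]] := basis 0.
have /(congr1 (@^~ (val i))) := etrans (esym (aU _ b0)) (aU (fun=> 0) z0).
by rewrite bE.
Qed.

(** Being orthogonal to [N] vectors is a system of [N] linear equations in the
[N + 1] coordinates along the first basis vectors. *)
Lemma schauder_basis_orthogonal (delta : nat -> H) (N : nat) (v : 'I_N -> H) :
  schauder_basis delta -> exists2 x, `|x| = 1 & forall i, inner x (v i) = 0.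
Proof.
move=> basis.
pose A := \matrix_(i < N.+1, j < N) inner (delta i) (v j).
have /rowV0Pn[u /sub_kermxP uA u0] : kermx A != 0.
  rewrite kermx_eq0 /row_free neq_ltn ltnS; apply/orP; left.
  exact: rank_leq_col.
pose x := \sum_(i < N.+1) u 0 i *: delta i.
have x0 : x != 0.
  apply: contra u0 => /eqP x0; apply/eqP/rowP => i; rewrite mxE.
  exact: (@schauder_basis_free delta _ (u 0) basis x0).
have xv i : inner x (v i) = 0.
  have /rowP/(_ i) := uA; rewrite !mxE => <-.
  by rewrite /x inner_suml; apply: eq_bigr => j _; rewrite innerZl mxE.
exists (`|x|^-1 *: x) => [|i]; last by rewrite innerZl xv mulr0.
by rewrite normrZ normfV normr_id mulVf ?normr_eq0.
Qed.

Lemma span_first_linear (delta : nat -> H) (k : nat) (x y : H) (a : R) :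
  span_first delta k x -> span_first delta k y ->
  span_first delta k (a *: x + y).
Proof.
move=> [b ->] [c ->]; exists (fun i => a * b i + c i).
rewrite scaler_sumr -big_split; apply: eq_bigr => i _.
by rewrite scalerA [in RHS]scalerDl.
Qed.

Lemma span_first0 (delta : nat -> H) (k : nat) : span_first delta k 0.
Proof. by exists (fun=> 0); rewrite big1 // => i _; rewrite scale0r. Qed.

Lemma span_first_series (delta : nat -> H) (a : nat -> R) (k : nat) :
  span_first delta k (series (fun i => a i *: delta i) k).
Proof. by exists (fun i => a i); rewrite /series /= big_mkord. Qed.

End scale_and_basis.

(** * A feasible sieve vector close to the principal direction *)

Lemma filter_forall_lt {T : Type} (F : set_system T) {FF : Filter F}
    (Q : nat -> T -> Prop) (m : nat) :
  (forall l, (1 <= l < m)%N -> \forall t \near F, Q l t) ->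
  \forall t \near F, forall l, (1 <= l < m)%N -> Q l t.
Proof.
move=> FQ.
suff : \forall t \near F, forall l : 'I_m, (1 <= l)%N -> Q l t.
  by apply: filterS => t Qt l /andP[l1 lm]; exact: (Qt (Ordinal lm)).
apply: filter_forall => l; have [l0|l0] := posnP l.
  by apply: nearW => t; rewrite l0.
by apply: filterS (FQ l _) => [t //|]; rewrite l0 /=.
Qed.

Section competitor.
Context {R : realType} {H : hilbertType R}.
Variables (delta : nat -> H) (k : nat -> nat) (phihat : nat -> nat -> H).
Variables (phi : nat -> H) (m : nat).
Hypothesis basis : schauder_basis delta.
Hypothesis k_infty : k n @[n --> \oo] --> \oo.
Hypothesis phi_feasible : forall l, (1 <= l <= m)%N -> feasible phi l (phi l).
Hypothesis phihat_feasible : forall l, (1 <= l < m)%N -> \forall n \near \oo,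
  (span_first delta (k n) `&` feasible (phihat n) l) (phihat n l).
Hypothesis phihat_cvg : forall l, (1 <= l < m)%N ->
  inner (phihat n l) (phi l) ^+ 2 @[n --> \oo] --> (1 : R).
Hypothesis m_gt0 : (0 < m)%N.

Lemma inner_phi_phihat_cvg0 l : (1 <= l < m)%N ->
  inner (phi m) (phihat n l) @[n --> \oo] --> (0 : R).
Proof.
move=> lm; have /andP[l1 lltm] := lm.
apply: (@bessel_two_cvg _ _ _ _ _ (fun n => phihat n l) (fun=> phi l)
  (fun=> phi m)); last first.
  by under eq_fun do rewrite innerC; exact: phihat_cvg.
have [phim mphi] : feasible phi m (phi m).
  by apply: phi_feasible; rewrite m_gt0 /=.
have [phil _] : feasible phi l (phi l).
  by apply: phi_feasible; rewrite l1 ltnW.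
apply: filterS (phihat_feasible _ lm) => n [_ [phl _]]; split => //.
exact: mphi.
Qed.

(** Project approximants [z n] of [phi m] taken from the sieve away from the
earlier estimators, which are orthonormal, and normalize. The correction
vanishes in the limit by [inner_phi_phihat_cvg0]. *)
Lemma sieve_competitor : exists2 y : nat -> H,
  y n @[n --> \oo] --> phi m &
  \forall n \near \oo, (span_first delta (k n) `&` feasible (phihat n) m) (y n).
Proof.
have [a [az _]] := basis (phi m).
pose z n := series (fun i => a i *: delta i) (k n).
have zphi : z n @[n --> \oo] --> phi m by exact: (cvg_comp _ _ k_infty az).
pose v n := z n - \sum_(1 <= l < m) inner (z n) (phihat n l) *: phihat n l.
have vphi : v n @[n --> \oo] --> phi m.
  rewrite -[phi m]subr0; apply: cvgB => //.
  rewrite [X in _ --> X](_ : 0 =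
    \sum_(1 <= l < m | (1 <= l < m)%N && true) (0 : H)); last by rewrite big1.
  under eq_fun do rewrite big_nat_cond.
  apply: cvg_big => [|l]; [exact: add_continuous|rewrite andbT => lm].
  have cz : inner (z n) (phihat n l) @[n --> \oo] --> (0 : R).
    rewrite (_ : (fun n => inner (z n) (phihat n l)) = (fun n =>
      inner (z n - phi m) (phihat n l) + inner (phi m) (phihat n l))); last first.
      by apply/funext => n; rewrite -innerDl subrK.
    rewrite -[X in _ --> X]addr0; apply: cvgD;
      last exact: inner_phi_phihat_cvg0.
    apply: norm_cvg0.
    have zphi0 : `|z n - phi m| @[n --> \oo] --> (0 : R).
      rewrite -(normr0 H) -(subrr (phi m)); apply: cvg_norm.
      by apply: cvgB => //; exact: cvg_cst.
    apply: (@squeeze_cvgr _ _ _ _ (fun=> 0) (fun n => `|z n - phi m|)) => //.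
    - apply: filterS (phihat_feasible _ lm) => n [_ [phl _]].
      rewrite normr_ge0 /=.
      by apply: le_trans (inner_cauchy_schwarz _ _) _; rewrite phl mulr1.
    - exact: cvg_cst.
  apply/cvgr0Pnorm_lt => e e0.
  have cze : \forall n \near \oo, `|inner (z n) (phihat n l)| < e.
    exact: cvgr0_norm_lt.
  apply: filterS2 (phihat_feasible _ lm) cze => n [_ [phl _]].
  by rewrite normrZ phl mulr1.
have phi1 : `|phi m| = 1 by have [] := @phi_feasible m _; rewrite ?m_gt0 /=.
have nv : `|v n| @[n --> \oo] --> (1 : R) by rewrite -phi1; exact: cvg_norm.
exists (fun n => `|v n|^-1 *: v n).
  rewrite -[phi m]scale1r; apply: cvgZ => //.
  by rewrite -[X in _ --> X]invr1; apply: cvgV.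
have v0 : \forall n \near \oo, `|v n| != 0.
  by apply: (cvgr_neq0 _ nv); rewrite oner_neq0.
apply: filterS2 (filter_forall_lt _ _ _ phihat_feasible) v0.
move=> n feas vn0; split; last split.
- rewrite -[_ *: _]addr0; apply: span_first_linear; last exact: span_first0.
  rewrite /v addrC -scaleN1r; apply: span_first_linear;
    last exact: span_first_series.
  rewrite big_nat_cond; apply: big_ind; first exact: span_first0.
    by move=> x y xs ys; rewrite -[x]scale1r; exact: span_first_linear.
  move=> l; rewrite andbT => /feas[spl _].
  by rewrite -[_ *: _]addr0; apply: span_first_linear => //; exact: span_first0.
- by rewrite normrZ normfV normr_id mulVf.
- move=> j jm; rewrite innerZl /v innerBl.
  suff -> : inner (\sum_(1 <= l < m) inner (z n) (phihat n l) *: phihat n l)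
    (phihat n j) = inner (z n) (phihat n j) by rewrite subrr mulr0.
  rewrite inner_suml.
  transitivity (\sum_(1 <= l < m | l == j) inner (z n) (phihat n l)); last first.
    by rewrite big_nat1_eq jm.
  rewrite [RHS]big_mkcond; apply: eq_big_nat => l lm; rewrite innerZl.
  have [_ [phl orl]] := feas _ lm; have [_ [phj orj]] := feas _ jm.
  have /andP[l1 _] := lm; have /andP[j1 _] := jm.
  have [->|jl] := eqVneq l j; first by rewrite inner_norm phj expr1n mulr1.
  rewrite neq_ltn in jl; case/orP: jl => [lj|jl].
    by rewrite (innerC (phihat n l)) orj ?mulr0 // l1.
  by rewrite orl ?mulr0 // j1.
Qed.

End competitor.

(** * Identification of the limits *)

Section consistency.
Context {R : realType} {H : hilbertType R}.
Variables (sigma : H -> R) (phi : nat -> H) (q : nat) (delta : nat -> H).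
Hypothesis sigma_ge0 : forall x, 0 <= sigma x.
Hypothesis sigmaZ : forall a x, sigma (a *: x) = `|a| * sigma x.
Hypothesis sigma_weak : continuous (sigma : weak H -> R).
Hypothesis phi_max : principal_directions sigma phi q.
Hypothesis phi_uniq : unique_up_to_sign sigma phi q.
Hypothesis basis : schauder_basis delta.

(** Otherwise every feasible unit vector is a maximizer, including one that is
orthogonal to [phi m]. *)
Lemma principal_scale_gt0 m : (1 <= m <= q)%N -> 0 < sigma (phi m).
Proof.
move=> mq; rewrite lt0r sigma_ge0 andbT; apply/negP => /eqP sm0.
have [[phim _] maxm] := phi_max _ mq.
have [x x1 xphi] :=
  @schauder_basis_orthogonal _ _ delta m (fun i => phi i.+1) basis.
have /andP[m1 _] := mq.
have xj j : (1 <= j <= m)%N -> inner x (phi j) = 0.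
  case: j => // j /= jm; exact: (xphi (Ordinal jm)).
have xfeas : feasible phi m x.
  by split => // j /andP[j1 jm]; apply: xj; rewrite j1 ltnW.
have : x = phi m \/ x = - phi m.
  by apply: phi_uniq => //; split => // y /maxm; rewrite sm0 => /le_trans; apply.
have := xj m; rewrite m1 leqnn => /(_ isT) xm [xE|xE]; move: xm.
  by rewrite xE inner_norm phim expr1n => /eqP; rewrite oner_eq0.
by rewrite xE innerNl inner_norm phim expr1n => /eqP; rewrite oppr_eq0 oner_eq0.
Qed.

Lemma scale_le_principal m a : (1 <= m <= q)%N ->
  (forall j, (1 <= j < m)%N -> inner a (phi j) = 0) ->
  sigma a <= `|a| * sigma (phi m).
Proof.
move=> mq aphi; have [_ maxm] := phi_max _ mq.
have [->|a0] := eqVneq a 0.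
  by rewrite -(scale0r 0) sigmaZ normr0 mul0r scale0r normr0 mul0r.
have na0 : `|a| != 0 by rewrite normr_eq0.
have -> : sigma a = `|a| * sigma (`|a|^-1 *: a).
  by rewrite sigmaZ normfV normr_id mulrA divff // mul1r.
rewrite ler_wpM2l //; apply: maxm; split => [|j jm].
  by rewrite normrZ normfV normr_id mulVf.
by rewrite innerZl aphi ?mulr0.
Qed.

(** A weak limit of unit vectors may lose norm; here the loss is excluded,
because by homogeneity it would lower the scale. *)
Lemma weak_maximizer m a : (1 <= m <= q)%N ->
  (forall j, (1 <= j < m)%N -> inner a (phi j) = 0) ->
  `|a| <= 1 -> sigma (phi m) <= sigma a -> a = phi m \/ a = - phi m.
Proof.
move=> mq aphi a1 sa; have sm0 := principal_scale_gt0 _ mq.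
have sle := scale_le_principal _ _ mq aphi.
have a1E : `|a| = 1.
  apply/eqP; rewrite eq_le a1 /= -(ler_pM2r sm0) mul1r.
  exact: le_trans sa sle.
apply: phi_uniq => //; split => // y yfeas.
by apply: le_trans sa; have [_] := phi_max _ mq; apply.
Qed.

(** Here [u] are the estimators of the [m]-th direction, [psi] those of the
earlier ones and [y] the competitors: the weak limit of [u] is feasible, and is
at least as good as the limit [phi m] of [y]. *)
Lemma ultra_sieve_cvg (G : set_system nat) {GU : UltraFilter G}
    (u y : nat -> H) (s : nat -> H -> R) (psi : nat -> nat -> H) m :
  (1 <= m <= q)%N ->
  (forall n x, 0 <= s n x) ->
  (\forall n \near G, feasible (psi n) m (u n)) ->
  (\forall n \near G, forall j, (1 <= j < m)%N -> `|psi n j| = 1) ->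
  (forall j, (1 <= j < m)%N ->
     inner (psi n j) (phi j) ^+ 2 @[n --> G] --> (1 : R)) ->
  y n @[n --> G] --> phi m ->
  (\forall n \near G, s n (y n) <= s n (u n)) ->
  s n (u n) ^+ 2 - sigma (u n) ^+ 2 @[n --> G] --> (0 : R) ->
  s n (y n) ^+ 2 - sigma (y n) ^+ 2 @[n --> G] --> (0 : R) ->
  sigma (u n) ^+ 2 @[n --> G] --> sigma (phi m) ^+ 2 /\
  inner (u n) (phi m) ^+ 2 @[n --> G] --> (1 : R).
Proof.
move=> mq s_ge0 ufeas psi1 psi_cvg yphi smax su sy.
have /andP[m1 mleq] := mq.
have u1 : \forall n \near G, `|u n| = 1 by apply: filterS ufeas => n [].
have [a ua] : exists a, forall x, inner (u n) x @[n --> G] --> inner a x.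
  by apply: (@ultra_weak_cvg _ _ _ _ _ _ 1); apply: filterS u1 => n ->.
have scvg (x : nat -> H) b : x n @[n --> G] --> (b : weak H) ->
    sigma (x n) ^+ 2 @[n --> G] --> sigma b ^+ 2.
  move=> xb; have sx : sigma (x n) @[n --> G] --> sigma b.
    exact: (cvg_comp _ _ xb (@sigma_weak b)).
  by rewrite expr2; under eq_fun do rewrite expr2; apply: cvgM.
have sua : sigma (u n) ^+ 2 @[n --> G] --> sigma a ^+ 2.
  by apply: scvg; exact: cvg_weak.
have syphi : sigma (y n) ^+ 2 @[n --> G] --> sigma (phi m) ^+ 2.
  by apply: scvg; apply: cvg_weak => x; apply: inner_cvg => //; exact: cvg_cst.
have na1 : `|a| <= 1.
  have : `|a| ^+ 2 <= `|a|.
    rewrite -inner_norm; apply: (cvgr_to_le (ua a)).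
    apply: filterS u1 => n un1; apply: le_trans (ler_norm _) _.
    by apply: le_trans (inner_cauchy_schwarz _ _) _; rewrite un1 mul1r.
  have := normr_ge0 a; rewrite expr2; nra.
have aphi j : (1 <= j < m)%N -> inner a (phi j) = 0.
  move=> jm; have /andP[j1 jltm] := jm.
  have ua0 : inner (u n) (phi j) @[n --> G] --> (0 : R).
    apply: (@bessel_two_cvg _ _ _ _ _ (fun=> phi j) (fun n => psi n j) u);
      last exact: psi_cvg.
    have [[phij _] _] : is_argmax (feasible phi j) sigma (phi j).
      by apply: phi_max; rewrite j1 (leq_trans _ mleq) // ltnW.
    apply: filterS2 ufeas psi1 => n [un1 orth] /(_ j jm) pj1; split => //.
    exact: orth.
  exact: (cvg_unique _ (ua (phi j)) ua0).
(* pass to the limit in [s n (y n) <= s n (u n)], writing each squared empirical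
   scale as the squared population scale plus the vanishing difference *)
have sphia : sigma (phi m) ^+ 2 <= sigma a ^+ 2.
  rewrite -subr_ge0.
  have lim : sigma (u n) ^+ 2 + (s n (u n) ^+ 2 - sigma (u n) ^+ 2)
      - (sigma (y n) ^+ 2 + (s n (y n) ^+ 2 - sigma (y n) ^+ 2)) @[n --> G] -->
      sigma a ^+ 2 + 0 - (sigma (phi m) ^+ 2 + 0).
    exact: (cvgB (cvgD sua su) (cvgD syphi sy)).
  rewrite !addr0 in lim; apply: (cvgr_to_ge lim).
  apply: filterS smax => n sn; rewrite !subrKC subr_ge0.
  by rewrite ler_pXn2r // nnegrE.
have sa : sigma (phi m) <= sigma a by rewrite -(@ler_pXn2r _ 2) // nnegrE.
have [[phim _] _] := phi_max _ mq.
have uphi : inner (u n) (phi m) ^+ 2 @[n --> G] --> inner a (phi m) ^+ 2.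
  by rewrite expr2; under eq_fun do rewrite expr2; apply: cvgM; exact: ua.
have [aE|aE] := weak_maximizer _ _ mq aphi na1 sa; rewrite aE in sua uphi.
  by split => //; move: uphi; rewrite inner_norm phim !expr1n.
split; first by move: sua; rewrite -scaleN1r sigmaZ normrN1 mul1r.
by move: uphi; rewrite innerNl inner_norm phim expr1n sqrrN expr1n.
Qed.

Variables (s : nat -> H -> R) (k : nat -> nat) (phihat : nat -> nat -> H).
Hypothesis s_ge0 : forall n x, 0 <= s n x.
Hypothesis s_unif : ereal_sup [set `|s n alpha ^+ 2 - sigma alpha ^+ 2|%:E |
    alpha in [set alpha | `|alpha| = 1]] @[n --> \oo] --> 0%E.
Hypothesis phihatE : sieve_estimators s delta k phihat q.
Hypothesis k_infty : k n @[n --> \oo] --> \oo.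

Lemma uniform_scale_cvg0 (u : nat -> H) : (\forall n \near \oo, `|u n| = 1) ->
  s n (u n) ^+ 2 - sigma (u n) ^+ 2 @[n --> \oo] --> (0 : R).
Proof.
move=> u1; apply/cvgr0Pnorm_lt => e e0.
pose gap n := [set `|s n alpha ^+ 2 - sigma alpha ^+ 2|%:E |
  alpha in [set alpha | `|alpha| = 1]].
have sup_lt : \forall n \near \oo, (ereal_sup (gap n) < e%:E)%E.
  apply: (s_unif [set y | (y < e%:E)%E]); apply: open_nbhs_nbhs; split.
    exact: open_ereal_lt_ereal.
  by rewrite /= lte_fin.
apply: filterS2 u1 sup_lt => n un1 supn.
rewrite -lte_fin; apply: le_lt_trans supn.
by apply: ereal_sup_ubound; exists (u n).
Qed.

Lemma near_sieve_estimator m : (1 <= m <= q)%N -> \forall n \near \oo,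
  is_argmax (span_first delta (k n) `&` feasible (phihat n) m) (s n)
    (phihat n m).
Proof.
move=> mq; have mk : \forall n \near \oo, (m <= k n)%N.
  exact: (k_infty [set j | (m <= j)%N] (nbhs_infty_ge m)).
by apply: filterS mk => n mkn; exact: phihatE.
Qed.

(** Strong induction: the convergence of the earlier squared cosines is what
makes the competitors converge and the weak limits feasible. *)
Lemma sieve_consistency m : (1 <= m <= q)%N ->
  [/\ s n (phihat n m) ^+ 2 @[n --> \oo] --> sigma (phi m) ^+ 2,
      sigma (phihat n m) ^+ 2 @[n --> \oo] --> sigma (phi m) ^+ 2 &
      inner (phihat n m) (phi m) ^+ 2 @[n --> \oo] --> (1 : R)].
Proof.
elim/ltn_ind: m => m IH mq; have /andP[m1 mleq] := mq.
have below l : (1 <= l < m)%N -> (1 <= l <= q)%N.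
  by move=> /andP[-> lm]; rewrite (leq_trans _ mleq) // ltnW.
have feas l : (1 <= l <= q)%N -> \forall n \near \oo,
    (span_first delta (k n) `&` feasible (phihat n) l) (phihat n l).
  by move=> lq; apply: filterS (near_sieve_estimator _ lq) => n [].
have IHcvg l : (1 <= l < m)%N ->
    inner (phihat n l) (phi l) ^+ 2 @[n --> \oo] --> (1 : R).
  by move=> lm; have /andP[_ ltm] := lm; have [] := IH l ltm (below _ lm).
have [y yphi yfeas] : exists2 y : nat -> H, y n @[n --> \oo] --> phi m &
    \forall n \near \oo,
      (span_first delta (k n) `&` feasible (phihat n) m) (y n).
  apply: sieve_competitor => // l lm; last by apply: feas; exact: below.
  have [] // := phi_max l _; case/andP: lm => -> lm.
  by rewrite (leq_trans lm).
have su0 : s n (phihat n m) ^+ 2 - sigma (phihat n m) ^+ 2 @[n --> \oo] -->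
    (0 : R).
  by apply: uniform_scale_cvg0; apply: filterS (feas _ mq) => n [_ []].
have sy0 : s n (y n) ^+ 2 - sigma (y n) ^+ 2 @[n --> \oo] --> (0 : R).
  by apply: uniform_scale_cvg0; apply: filterS yfeas => n [_ []].
have psi1 : \forall n \near \oo, forall j, (1 <= j < m)%N -> `|phihat n j| = 1.
  apply: filter_forall_lt => j jm.
  by apply: filterS (feas j (below _ jm)) => n [_ []].
have ultra (G : set_system nat) : UltraFilter G -> \oo `<=` G ->
    sigma (phihat n m) ^+ 2 @[n --> G] --> sigma (phi m) ^+ 2 /\
    inner (phihat n m) (phi m) ^+ 2 @[n --> G] --> (1 : R).
  move=> GU ooG; have sub (U : topologicalType) (f : nat -> U) (l : U) :
      f n @[n --> \oo] --> l -> f n @[n --> G] --> l.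
    by move=> fl A /fl; exact: ooG.
  apply: (@ultra_sieve_cvg G _ _ y s phihat) => //.
  - by apply: ooG; apply: filterS (feas _ mq) => n [].
  - exact: ooG.
  - by move=> j jm; apply: sub; exact: IHcvg.
  - exact: sub.
  - apply: ooG; apply: filterS2 (near_sieve_estimator _ mq) yfeas.
    by move=> n [_ nmax] yn; exact: nmax.
  - exact: (sub _ _ _ su0).
  - exact: (sub _ _ _ sy0).
have sigma_cvg : sigma (phihat n m) ^+ 2 @[n --> \oo] --> sigma (phi m) ^+ 2.
  by apply: cvg_ultra => G GU ooG; have [] := ultra G GU ooG.
split => //; last by apply: cvg_ultra => G GU ooG; have [] := ultra G GU ooG.
rewrite -[sigma (phi m) ^+ 2]addr0.
rewrite (_ : (fun n => s n (phihat n m) ^+ 2) = (fun n =>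
  sigma (phihat n m) ^+ 2 + (s n (phihat n m) ^+ 2 - sigma (phihat n m) ^+ 2))).
  exact: cvgD sigma_cvg su0.
by apply/funext => n; rewrite subrKC.
Qed.

End consistency.

(** * Almost sure consistency *)

Theorem theorem4p2 (R : realType) (H : hilbertType R)
    (d : measure_display) (Omega : measurableType d) (Pr : probability Omega R)
    (P : probability (borel H) R) (X : nat -> {RV Pr >-> borel H})
    (sigmaR : probability R R -> R)
    (q : nat) (phi : nat -> H)
    (delta : nat -> H) (p : nat -> nat) (phihat : nat -> nat -> Omega -> H) :
  let sigma := projected_scale sigmaR P in
  let s n w := projected_scale sigmaR (empirical (fun i => X i w) n) in
  let lambdahat n m w := s n w (phihat n m w) ^+ 2 in
  separable H ->
  scale_functional sigmaR ->
  mutually_independent Pr X ->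
  (forall i A, measurable A -> distribution Pr (X i) A = P A) ->
  (2 <= q)%N ->
  principal_directions sigma phi q ->
  unique_up_to_sign sigma phi q ->
  continuous (sigma : weak H -> R) ->
  {ae Pr, forall w,
    ereal_sup [set `|s n w alpha ^+ 2 - sigma alpha ^+ 2|%:E |
               alpha in [set alpha | `|alpha| = 1]] @[n --> \oo] --> 0%E} ->
  schauder_basis delta ->
  (forall w, sieve_estimators (s ^~ w) delta p (fun n m => phihat n m w) q) ->
  p n @[n --> \oo] --> \oo ->
  [/\ {ae Pr, forall w, lambdahat n 1%N w @[n --> \oo] --> sigma (phi 1%N) ^+ 2}
      /\ {ae Pr, forall w,
           sigma (phihat n 1%N w) ^+ 2 @[n --> \oo] --> sigma (phi 1%N) ^+ 2},
      forall m, (2 <= m <= q)%N ->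
        (forall l, (1 <= l <= m.-1)%N ->
          {ae Pr, forall w, phihat n l w @[n --> \oo] --> phi l}) ->
        {ae Pr, forall w, lambdahat n m w @[n --> \oo] --> sigma (phi m) ^+ 2}
        /\ {ae Pr, forall w,
             sigma (phihat n m w) ^+ 2 @[n --> \oo] --> sigma (phi m) ^+ 2} &
      forall m, (1 <= m <= q)%N ->
        {ae Pr, forall w,
          inner (phihat n m w) (phi m) ^+ 2 @[n --> \oo] --> (1 : R)}].
Proof.
move=> sigma s lambdahat _ scale _ _ q2 phi_max phi_uniq sigma_weak s_unif basis
  phihatE p_infty.
have all_cvg : {ae Pr, forall w, forall m, (1 <= m <= q)%N ->
  [/\ lambdahat n m w @[n --> \oo] --> sigma (phi m) ^+ 2,
      sigma (phihat n m w) ^+ 2 @[n --> \oo] --> sigma (phi m) ^+ 2 &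
      inner (phihat n m w) (phi m) ^+ 2 @[n --> \oo] --> (1 : R)]}.
  apply: filterS s_unif => w s_unif m mq.
  have [_ sR_ge0 _] := scale.
  apply: (@sieve_consistency _ _ sigma phi q delta _ _ _ _ _ _ (fun n => s n w) p
    (fun n m => phihat n m w)) => //; try exact: phihatE.
  - by move=> x; exact: sR_ge0.
  - by move=> a x; exact: projected_scaleZ.
  - by move=> n x; exact: sR_ge0.
split; [split|move=> m /andP[m2 mq] _|move=> m mq].
- by apply: filterS all_cvg => w /(_ 1%N (ltnW q2)) [].
- by apply: filterS all_cvg => w /(_ 1%N (ltnW q2)) [].
- have mq1 : (1 <= m <= q)%N by rewrite mq (ltnW m2).
  by split; apply: filterS all_cvg => w /(_ m mq1) [].
- by apply: filterS all_cvg => w /(_ m mq) [].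
Qed.
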